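(* Let $k\ge1$ and let $u_1,\dots,u_k$ be indeterminates (treated as scalars). Define operators on polynomials in $\mathbf p$ by $$B^{(k)}_m f:=(m-1)!\,\Theta_Y\Big(Y_+\prod_{i=1}^k(\Lambda_Y+u_i)\Big)^m\Big(\frac{y_0}{1+b}f\Big),\quad m\ge1,$$ $$\Omega^{(k)}_Yf:=\Theta_YY_+\prod_{j=1}^k(\Lambda_Y+u_j)\Lambda_Y\Big(\frac{y_0}{1+b}f\Big).$$ Then $B^{(k)}_1f=\Theta_YY_+\prod_{j=1}^k(\Lambda_Y+u_j)\big(\frac{y_0}{1+b}f\big)$ and $B^{(k)}_{m+1}=[\Omega^{(k)}_Y,B^{(k)}_m]$ for all $m\ge1$, as operators on polynomials in $p_1,p_2,\dots$ (with coefficients in $\mathbb Q(b)$, the $u_i$ being scalars).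
   Context: Variables $b$, $\mathbf p=(p_i)_{i\ge1}$, $\bm y=(y_i)_{i\ge0}$. Operators: $\Theta_Y=\sum_{i\ge1}p_i\frac{\partial}{\partial y_i}$; $Y_+=\sum_{i\ge0}y_{i+1}\frac{\partial}{\partial y_i}$; $\Lambda_Y=(1+b)\sum_{i,j\ge1}iy_{i+j-1}\frac{\partial^2}{\partial p_i\partial y_{j-1}}+\sum_{i,j\ge1}y_{i-1}p_j\frac{\partial}{\partial y_{i+j-1}}+b\sum_{i\ge0}iy_i\frac{\partial}{\partial y_i}$. $[A,B]=AB-BA$. *)

(* Defs.v *)
From HB Require Import structures.
From mathcomp Require Import all_boot all_order all_algebra.
From mathcomp Require Import finmap.
From mathcomp Require Import monalg.
Set Implicit Arguments. Unset Strict Implicit. Unset Printing Implicit Defensive.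
Import Order.TTheory GRing.Theory Num.Theory.
Local Open Scope ring_scope.

(* Variables: inl i is p_i (only i >= 1 is used), inr i is y_i. *)
Definition var := (nat + nat)%type.
Definition pv (i : nat) : var := inl i.
Definition yv (i : nat) : var := inr i.
Definition vidx (v : var) : nat := match v with inl i => i | inr i => i end.

Definition polyPY (F : fieldType) := {malg F[{cmonom var}]}.

Section Ops.
Variable F : fieldType.
Implicit Types (g : polyPY F) (v : var).

Definition X v : polyPY F := << ucm v >>.

Definition pd v g : polyPY F :=
  \sum_(m <- msupp g) << g@_m * (m v)%:R *g divcm m (ucm v) >>.

(* a strict upper bound on the indices of all variables occurring in g;
   all infinite sums below have only finitely many nonzero terms, all of
   them with indices below this bound (+1), so the sums are truncated there *)
Definition vbound g : nat :=
  (\max_(m <- msupp g) \max_(v <- finsupp (cmonom_val m)) (vidx v).+1)%N.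

Definition ThetaY g : polyPY F :=
  \sum_(1 <= i < (vbound g).+1) X (pv i) * pd (yv i) g.

Definition Yplus g : polyPY F :=
  \sum_(0 <= i < (vbound g).+1) X (yv i.+1) * pd (yv i) g.

Definition LambdaY (b : F) g : polyPY F :=
  (1 + b) *: (\sum_(1 <= i < (vbound g).+1) \sum_(1 <= j < (vbound g).+1)
       i%:R * X (yv (i + j - 1)) * pd (pv i) (pd (yv (j - 1)) g))
  + (\sum_(1 <= i < (vbound g).+1) \sum_(1 <= j < (vbound g).+1)
       X (yv (i - 1)) * X (pv j) * pd (yv (i + j - 1)) g)
  + b *: (\sum_(0 <= i < (vbound g).+1) i%:R * X (yv i) * pd (yv i) g).

Fixpoint prodLambda (b : F) (us : seq F) g : polyPY F :=
  match us with
  | [::] => g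
  | c :: us' => LambdaY b (prodLambda b us' g) + c *: prodLambda b us' g
  end.

Definition useq (k : nat) (u : 'I_k -> F) : seq F := [seq u i | i <- enum 'I_k].

Definition y0div (b : F) g : polyPY F := (1 + b)^-1 *: (X (yv 0) * g).

Definition Bk (b : F) (k : nat) (u : 'I_k -> F) (m : nat) g : polyPY F :=
  (m.-1)`!%:R *: ThetaY
    (iter m (fun h => Yplus (prodLambda b (useq u) h)) (y0div b g)).

Definition OmegaY (b : F) (k : nat) (u : 'I_k -> F) g : polyPY F :=
  ThetaY (Yplus (prodLambda b (useq u) (LambdaY b (y0div b g)))).

Definition is_ppoly g : Prop :=
  forall m, m \in msupp g -> forall i, (cmonom_val m) (yv i) = 0%N /\ (cmonom_val m) (pv 0) = 0%N.

End Ops.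

(* Main.v *)
(* On the part linear in the y's, write t^n for y_n. Then Y_+ is multiplication
   by t, Lambda_Y is the Nazarov-Sklyanin Lax operator L on Q[p][t], with
     [L, t] = b t + iota Theta t          (iota f := f t^0),
   and, with A := t prod (L + u_i), B_m = (m-1)! Theta A^m iota / (1+b) and
   Omega = Theta A L iota / (1+b).
   The Laplace-Beltrami operator D on Q[p] has a lift D~ to Q[p][t] such that
   D~ iota = iota D, D Theta = Theta D~, [D~, L] = 0 and [D~, t] = t L. Starting
   from p_1/(1+b), which satisfies [p_1/(1+b), L] = -t, iterated commutators with
   D (and D~) therefore produce Omega together with a lift E of it with
   E iota = iota Omega, Omega Theta = Theta E and, writing A = t P(L),
     [E, L] = - A L,     [E, t] = t d(P(L) L),
   where d is the derivation with d L = t. Since [P(L), t] = [L, d P(L)], this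
   gives [E, A] = A^2, so [E, A^m] = m A^(m+1), and sandwiching between Theta and
   iota yields [Omega, B_m] = B_(m+1). *)
Require Import Defs.
From HB Require Import structures.
From mathcomp Require Import all_boot all_order all_algebra.
From mathcomp Require Import finmap.
From mathcomp Require Import monalg.
From mathcomp Require Import ring.
Set Implicit Arguments. Unset Strict Implicit. Unset Printing Implicit Defensive.
Import GRing.Theory.
Local Open Scope ring_scope.

(** * Additive maps on polynomials prescribed on monomials *)

Section LinearExtension.
Variables (A : comNzRingType) (V : zmodType) (G : nat -> {additive A -> V}).

(** The [G i] are only additive, since the gradient part of the Lax operator differentiates
    coefficients. *)
Definition lext (g : {poly A}) : V := \sum_(i < size g) G i g`_i.

Lemma lextEw n (g : {poly A}) : (size g <= n)%N -> lext g = \sum_(i < n) G i g`_i.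
Proof.
move=> le_gn; rewrite /lext (big_ord_widen n (fun i => G i g`_i) le_gn).
rewrite big_mkcond; apply: eq_bigr => i _; case: ltnP => // le_gi.
by rewrite nth_default // raddf0.
Qed.

Fact lext_zmod_morphism : zmod_morphism lext.
Proof.
move=> g h; pose n := maxn (size g) (size h).
rewrite (@lextEw n (g - h)) ?(leq_trans (size_polyD _ _)) ?size_polyN //.
rewrite (@lextEw n g) ?leq_maxl // (@lextEw n h) ?leq_maxr // -sumrB.
by apply: eq_bigr => i _; rewrite coefB raddfB.
Qed.
HB.instance Definition _ :=
  GRing.isZmodMorphism.Build {poly A} V lext lext_zmod_morphism.

Lemma lextXn c n : lext (c *: 'X^n) = G n c.
Proof.
rewrite (@lextEw n.+1); last first.
  by apply: leq_trans (size_scale_leq _ _) _; rewrite size_polyXn.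
rewrite big_ord_recr /= big1 ?add0r ?coefZ ?coefXn ?eqxx ?mulr1 // => i _.
by rewrite coefZ coefXn ltn_eqF ?mulr0 ?raddf0.
Qed.

End LinearExtension.

(** Testing on every [c *: 'X^n], not just on ['X^n], makes up for the missing linearity over
    [A]. *)
Lemma poly_monomialW (A : comNzRingType) (V : zmodType) (f g : {poly A} -> V) :
  {morph f : x y / x + y} -> {morph g : x y / x + y} ->
  (forall c n, f (c *: 'X^n) = g (c *: 'X^n)) -> f =1 g.
Proof.
move=> fD gD fg h.
have f0 : f 0 = 0 by apply: (addrI (f 0)); rewrite -fD !addr0.
have g0 : g 0 = 0 by apply: (addrI (g 0)); rewrite -gD !addr0.
rewrite -[h]coefK poly_def (big_morph f fD f0) (big_morph g gD g0).
by apply: eq_bigr => i _.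
Qed.

(** * Commutator calculus from abstract relations between [Lam] and [LBt] *)

Section Lax.
Variables (A : comNzRingType) (const : A -> Prop).
Variables (Theta : {additive {poly A} -> A}) (LB : {additive A -> A}).
Variables Lam LBt : {additive {poly A} -> {poly A}}.
Hypothesis const0 : const 0.
Hypothesis ThetaZ : forall c g, Theta (c *: g) = c * Theta g.
Hypothesis LB_const : forall c f, const c -> LB (c * f) = c * LB f.
Hypothesis Lam_const : forall c g, const c -> Lam (c *: g) = c *: Lam g.
Hypothesis LBt_const : forall c g, const c -> LBt (c *: g) = c *: LBt g.
Hypothesis LBtC : forall f, LBt f%:P = (LB f)%:P.
Hypothesis LB_Theta : forall g, LB (Theta g) = Theta (LBt g).
Hypothesis LBtX : forall g, LBt ('X * g) = 'X * LBt g + 'X * Lam g.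
Hypothesis LBt_Lam : forall g, LBt (Lam g) = Lam (LBt g).
Let LamD : {morph Lam : x y / x + y} := raddfD Lam.
Let LamB : {morph Lam : x y / x - y} := raddfB Lam.
Let LBtD : {morph LBt : x y / x + y} := raddfD LBt.
Let LBtB : {morph LBt : x y / x - y} := raddfB LBt.
Variable ai : A.
Hypothesis cai : const ai.
(** With [ai] = 1/(1+b) and [Theta 'X] = p_1 this is [L, p_1/(1+b)] = t, the seed of all commutators
    below. *)
Hypothesis LamZ : forall g,
  Lam ((ai * Theta 'X) *: g) = (ai * Theta 'X) *: Lam g + 'X * g.

Implicit Types (us vs : seq A) (g : {poly A}).

Fixpoint prodLam us g :=
  if us is c :: us' then Lam (prodLam us' g) + c *: prodLam us' g else g.

(* Each factor [Lam + c] of the product is created by one commutator with the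
   Laplace-Beltrami operator, upstairs ([OmegaLift], on ['X]-polynomials) and
   downstairs ([OmegaBase]); [OmegaBase us] is the operator
   Theta_Y Y_+ prod (Lambda_Y + c) y_0/(1+b), see [OmegaBaseE]. *)
Fixpoint OmegaLift us g : {poly A} :=
  if us is c :: us' then
    LBt (OmegaLift us' g) - OmegaLift us' (LBt g) + c *: OmegaLift us' g
  else (ai * Theta 'X) *: g.

Fixpoint OmegaBase us f : A :=
  if us is c :: us' then LB (OmegaBase us' f) - OmegaBase us' (LB f) + c * OmegaBase us' f
  else ai * Theta 'X * f.

(* The image of [prodLam us] under the derivation of noncommutative polynomials
   sending [Lam] to multiplication by ['X]. *)
Fixpoint lambda_der us g : {poly A} :=
  if us is c :: us' then
    'X * prodLam us' g + (Lam (lambda_der us' g) + c *: lambda_der us' g)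
  else 0.

Definition consts us := forall c, c \in us -> const c.

Lemma consts_cons c us : consts (c :: us) -> const c /\ consts us.
Proof.
move=> cus; split=> [|d d_us]; first by apply: cus; rewrite mem_head.
by apply: cus; rewrite inE d_us orbT.
Qed.

Lemma OmegaLiftD us : {morph OmegaLift us : x y / x + y}.
Proof.
elim: us => [|c us IH] x y /=; first exact: scalerDr.
rewrite !LBtD !IH LBtD scalerDr; ring.
Qed.

Lemma prodLamD us : {morph prodLam us : x y / x + y}.
Proof. by elim: us => [|c us IH] x y //=; rewrite IH LamD scalerDr; ring. Qed.

Lemma OmegaLift_const c us g : const c -> OmegaLift us (c *: g) = c *: OmegaLift us g.
Proof.
move=> cc; elim: us g => [|d us IH] g /=.
  by rewrite !scalerA mulrC.
rewrite IH !LBt_const // IH -!mul_polyC; ring.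
Qed.

Lemma prodLam_Lam us g : consts us -> prodLam us (Lam g) = Lam (prodLam us g).
Proof.
elim: us => [|c us IH] //= /consts_cons[cc cus].
by rewrite IH // LamD Lam_const.
Qed.

Lemma prodLam_const us c g :
  consts us -> const c -> prodLam us (c *: g) = c *: prodLam us g.
Proof.
move=> cus cc; elim: us cus => [|d us IH] //= /consts_cons[cd cus].
rewrite IH // Lam_const // -!mul_polyC; ring.
Qed.

Lemma prodLam_prodLam us vs g : consts us -> consts vs ->
  prodLam us (prodLam vs g) = prodLam vs (prodLam us g).
Proof.
move=> cus; elim: vs => [|c vs IH] //= /consts_cons[cc cvs].
by rewrite prodLamD prodLam_Lam // prodLam_const // IH.
Qed.

Lemma LBt_prodLam us g : consts us -> LBt (prodLam us g) = prodLam us (LBt g).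
Proof.
elim: us => [|c us IH] //= /consts_cons[cc cus].
by rewrite LBtD LBt_Lam LBt_const // IH.
Qed.

(** Compatibility with constants holds for multiplication by p_1/(1+b) and survives each commutator
    by [LBtC]. *)
Lemma OmegaLiftC us f : OmegaLift us f%:P = (OmegaBase us f)%:P.
Proof.
elim: us f => [|c us IH] f /=; first by rewrite -mul_polyC -polyCM.
by rewrite !(IH, LBtC) -mul_polyC -polyCM polyCD polyCB.
Qed.

Lemma OmegaBase_Theta us g : OmegaBase us (Theta g) = Theta (OmegaLift us g).
Proof.
elim: us g => [|c us IH] g /=; first by rewrite ThetaZ.
by rewrite (raddfD Theta) (raddfB Theta) ThetaZ -!LB_Theta -!IH LB_Theta.
Qed.

(** Jacobi identity: as D~ commutes with L and with the product P over [us'], [[D~, E], L] = [D~,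
    [E, L]] = -[D~, t P] = -t L P. *)
Lemma OmegaLift_Lam us g :
  consts us -> OmegaLift us (Lam g) = Lam (OmegaLift us g) - 'X * prodLam us g.
Proof.
elim: us g => [|c us IH] g /=.
  by move=> _; rewrite LamZ addrK.
case/consts_cons=> cc cus.
rewrite IH // LBt_Lam IH // LBtB LBtX LBt_Lam LBt_prodLam // LamD LamB Lam_const //.
rewrite -!mul_polyC; ring.
Qed.

(** Every term of [lambda_der] contains t exactly once. There [D~, t] = t L leaves an L, which
    slides to the right end past polynomials in L. *)
Lemma LBt_lambda_der us g : consts us ->
  LBt (lambda_der us g) = lambda_der us (LBt g) + lambda_der us (Lam g).
Proof.
elim: us g => [|c us IH] g /=; first by rewrite raddf0 addr0.
case/consts_cons=> cc cus.
rewrite !LBtD LBtX LBt_Lam LBt_const // IH // LamD LBt_prodLam // prodLam_Lam //.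
rewrite -!mul_polyC; ring.
Qed.

(** Jacobi again: [[D~, E], t] = [D~, t dP] - [E, t L]. The two copies of t dP L cancel, leaving t
    (L dP + t P). *)
Lemma OmegaLift_X us g : consts us ->
  OmegaLift us ('X * g) = 'X * OmegaLift us g + 'X * lambda_der us g.
Proof.
elim: us g => [|c us IH] g /=.
  by move=> _; rewrite mulr0 addr0 scalerAr.
case/consts_cons=> cc cus.
rewrite IH // LBtD !LBtX LBt_lambda_der // OmegaLiftD !IH // OmegaLift_Lam //.
rewrite -!mul_polyC; ring.
Qed.

(** Apply d, with d L = t, to [L, P] = 0. *)
Lemma Lam_lambda_der us g : consts us ->
  Lam (lambda_der us g) - lambda_der us (Lam g) = prodLam us ('X * g) - 'X * prodLam us g.
Proof.
elim: us g => [|c us IH] g /=; first by rewrite raddf0 !subrr.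
case/consts_cons=> cc cus.
have /(canRL (subrK _)) -> := esym (IH g cus).
rewrite !(LamD, LamB) !Lam_const // prodLam_Lam // -!mul_polyC; ring.
Qed.

(** Between [Theta] and constants, the commutator with [LB] becomes [D~, t P] = t L P, so each step
    gains one factor. *)
Lemma OmegaBaseE us f : consts us -> OmegaBase us f = ai * Theta ('X * prodLam us f%:P).
Proof.
elim: us f => [|c us IH] f /=.
  by rewrite mulrC mulrCA ['X * _]mulrC mul_polyC ThetaZ.
case/consts_cons=> cc cus.
rewrite !IH // LB_const // LB_Theta LBtX LBt_prodLam // LBtC mulrDr (raddfD Theta).
rewrite -scalerAr (raddfD Theta) ThetaZ; ring.
Qed.

Section Main.
Variable us : seq A.
Hypothesis cus : consts us.
(* Omega carries one factor [Lam] more than B_1. *)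
Let R := 0 :: us.

Lemma constsR : consts R.
Proof.
move=> c; rewrite inE => /predU1P[->|]; last exact: cus.
exact: const0.
Qed.

(** On L the commutator with E is -t L P = -(d L) L P. Since L P commutes with L, it is -(d Q) L P
    for every product Q of factors L + c. *)
Lemma OmegaLift_prodLam vs g : consts vs ->
  OmegaLift R (prodLam vs g) =
  prodLam vs (OmegaLift R g) - lambda_der vs (Lam (prodLam us g)).
Proof.
elim: vs g => [|c vs IH] g; first by rewrite subr0.
case/consts_cons=> cc cvs.
rewrite [prodLam (c :: vs) g]/= OmegaLiftD OmegaLift_const // OmegaLift_Lam;
  last exact: constsR.
rewrite IH // [prodLam R _]/= scale0r addr0 prodLam_prodLam //.
rewrite LamB /= -!mul_polyC prodLam_Lam //; ring.
Qed.

Definition step g := 'X * prodLam us g.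

(** [E, t P] = t d(L P) P - t dP L P = t (t P + [L, dP]) P, and [L, dP] = P t - t P turns this into
    t P t P. *)
Lemma OmegaLift_step g : OmegaLift R (step g) = step (OmegaLift R g) + step (step g).
Proof.
rewrite /step OmegaLift_X; last exact: constsR.
rewrite OmegaLift_prodLam // -!mulrDr; congr (_ * _).
have /(canRL (subrK _)) -> := esym (Lam_lambda_der (prodLam us g) cus).
rewrite /= !scale0r; ring.
Qed.

Lemma OmegaLift_iter_step m g :
  OmegaLift R (iter m step g) = iter m step (OmegaLift R g) + iter m.+1 step g *+ m.
Proof.
elim: m => [|m IH]; first by rewrite addr0.
have stepD : {morph step : x y / x + y} by move=> x y; rewrite /step prodLamD mulrDr.
have step0 : step 0 = 0 by apply: (addrI (step 0)); rewrite -stepD !addr0.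
have stepMn x n : step (x *+ n) = step x *+ n.
  by elim: n => [|n IHn]; rewrite ?mulr0n // !mulrS stepD IHn.
by rewrite iterS OmegaLift_step IH stepD stepMn mulrSr addrA.
Qed.

Definition OmegaQ f := ai * Theta ('X * prodLam us (Lam f%:P)).

Lemma OmegaQE f : OmegaBase R f = OmegaQ f.
Proof. by rewrite (OmegaBaseE _ constsR) /= scale0r addr0 /OmegaQ prodLam_Lam. Qed.

Lemma OmegaQ_const c f : const c -> OmegaQ (c * f) = c * OmegaQ f.
Proof.
move=> cc; rewrite /OmegaQ polyCM mul_polyC Lam_const // prodLam_const //.
by rewrite -scalerAr ThetaZ mulrCA.
Qed.

Lemma iter_step_const m c g : const c -> iter m step (c *: g) = c *: iter m step g.
Proof.
by move=> cc; elim: m => [|m IH] //=; rewrite IH /step prodLam_const // scalerAr.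
Qed.

Lemma OmegaQ_commutator m f :
  OmegaQ (Theta (iter m step f%:P)) - Theta (iter m step (OmegaQ f)%:P) =
  Theta (iter m.+1 step f%:P) *+ m.
Proof.
rewrite -!OmegaQE OmegaBase_Theta OmegaLift_iter_step OmegaLiftC (raddfD Theta) addrC addKr.
by rewrite raddfMn.
Qed.
End Main.

End Lax.

(** * The Lax and Laplace-Beltrami operators, built from a gradient *)

Section Fock.
(** [N f] encodes the gradient: the sum over l of l (df/dp_l) X^l. Then [NC] is the symmetry of
    second derivatives. *)
Variables (A : comNzRingType) (p : nat -> A) (N : {additive A -> {poly A}}).
Hypothesis p0 : p 0 = 0.
Hypothesis NM : forall f g, N (f * g) = f *: N g + g *: N f.
Hypothesis Np : forall l, N (p l) = l%:R *: 'X^l.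
Hypothesis NC : forall f r s, (N (N f)`_r)`_s = (N (N f)`_s)`_r.

Definition isconst c := N c = 0.

Lemma N_const c f : isconst c -> N (c * f) = c *: N f.
Proof. by move=> c0; rewrite NM c0 scaler0 addr0. Qed.

(** To be instantiated with [a] as 1 + b and [h] as one half. *)
Variables (a b h : A).
Hypotheses (ca : isconst a) (cb : isconst b) (ch : isconst h).
Hypothesis h2 : h + h = 1.

Definition pmul i (c : A) := p i * c.
Fact pmul_additive i : zmod_morphism (pmul i).
Proof. by move=> x y; rewrite /pmul mulrBr. Qed.
HB.instance Definition _ i :=
  GRing.isZmodMorphism.Build A A (pmul i) (pmul_additive i).

Definition Xmul i (c : A) := 'X^i * N c.
Fact Xmul_additive i : zmod_morphism (Xmul i).
Proof. by move=> x y; rewrite /Xmul raddfB mulrBr. Qed.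
HB.instance Definition _ i :=
  GRing.isZmodMorphism.Build A {poly A} (Xmul i) (Xmul_additive i).

(** Multiplication by the sum of the p_j X^(-j), projected onto nonnegative powers of X. *)
Definition jmul i (c : A) := \sum_(j < i.+1) (p j * c) *: 'X^(i - j).
Fact jmul_additive i : zmod_morphism (jmul i).
Proof.
move=> x y; rewrite /jmul -sumrB; apply: eq_bigr => j _.
by rewrite mulrBr scalerBl.
Qed.
HB.instance Definition _ i :=
  GRing.isZmodMorphism.Build A {poly A} (jmul i) (jmul_additive i).

Definition Theta : {poly A} -> A := lext pmul.
Definition gradt : {poly A} -> {poly A} := lext Xmul.
Definition Jneg : {poly A} -> {poly A} := lext jmul.
HB.instance Definition _ := GRing.Additive.on Theta.
HB.instance Definition _ := GRing.Additive.on gradt.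
HB.instance Definition _ := GRing.Additive.on Jneg.

Definition Euler (g : {poly A}) := 'X * g^`().
Fact Euler_additive : zmod_morphism Euler.
Proof. by move=> x y; rewrite /Euler derivB mulrBr. Qed.
HB.instance Definition _ :=
  GRing.isZmodMorphism.Build {poly A} {poly A} Euler Euler_additive.

Definition Lam (g : {poly A}) := a *: gradt g + Jneg g + b *: Euler g.
Fact Lam_additive : zmod_morphism Lam.
Proof. by move=> x y; rewrite /Lam !raddfB /=; ring. Qed.
HB.instance Definition _ :=
  GRing.isZmodMorphism.Build {poly A} {poly A} Lam Lam_additive.

Lemma ThetaD : {morph Theta : x y / x + y}. Proof. exact: raddfD. Qed.
Lemma LamD : {morph Lam : x y / x + y}. Proof. exact: raddfD. Qed.

Lemma ThetaXn c n : Theta (c *: 'X^n) = p n * c.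
Proof. exact: lextXn. Qed.
Lemma gradtXn c n : gradt (c *: 'X^n) = 'X^n * N c.
Proof. exact: lextXn. Qed.
Lemma JnegXn c n : Jneg (c *: 'X^n) = \sum_(j < n.+1) (p j * c) *: 'X^(n - j).
Proof. exact: lextXn. Qed.
Lemma EulerXn c n : Euler (c *: 'X^n) = (c *+ n) *: 'X^n.
Proof.
rewrite /Euler derivZ derivXn; case: n => [|n].
  by rewrite !mulr0n scaler0 mulr0 scale0r.
by rewrite -scalerAr mulrnAr -exprS -scalerMnl scalerMnr.
Qed.

Lemma ThetaZ c g : Theta (c *: g) = c * Theta g.
Proof.
apply: (poly_monomialW (f := fun g => Theta (c *: g)) (g := fun g => c * Theta g)).
- by move=> x y; rewrite scalerDr raddfD.
- by move=> x y; rewrite raddfD /= mulrDr.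
- by move=> d n; rewrite scalerA !ThetaXn; ring.
Qed.

Lemma Theta_Xn n : Theta 'X^n = p n.
Proof. by rewrite -[X in Theta X]scale1r ThetaXn mulr1. Qed.

Lemma JnegZ c g : Jneg (c *: g) = c *: Jneg g.
Proof.
apply: (poly_monomialW (f := fun g => Jneg (c *: g)) (g := fun g => c *: Jneg g)).
- by move=> x y; rewrite scalerDr raddfD.
- by move=> x y; rewrite raddfD /= scalerDr.
- move=> d n; rewrite scalerA !JnegXn scaler_sumr; apply: eq_bigr => j _.
  by rewrite scalerA mulrCA.
Qed.

Lemma EulerZ c g : Euler (c *: g) = c *: Euler g.
Proof. by rewrite /Euler derivZ scalerAr. Qed.

Lemma gradtZ c g : gradt (c *: g) = c *: gradt g + N c * g.
Proof.
apply: (poly_monomialW (f := fun g => gradt (c *: g))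
  (g := fun g => c *: gradt g + N c * g)).
- by move=> x y; rewrite scalerDr raddfD.
- by move=> x y; rewrite raddfD /= scalerDr mulrDr; ring.
- move=> d n; rewrite scalerA !gradtXn NM -!mul_polyC; ring.
Qed.

Lemma LamZ c g : Lam (c *: g) = c *: Lam g + a *: (N c * g).
Proof. rewrite /Lam gradtZ JnegZ EulerZ -!mul_polyC; ring. Qed.

Lemma gradtC c : gradt c%:P = N c.
Proof. by rewrite -[_%:P]alg_polyC -(expr0 'X) gradtXn mul1r. Qed.
Lemma JnegC c : Jneg c%:P = 0.
Proof.
by rewrite -[_%:P]alg_polyC -(expr0 'X) JnegXn big_ord1 p0 mul0r scale0r.
Qed.
Lemma EulerC c : Euler c%:P = 0.
Proof. by rewrite /Euler derivC mulr0. Qed.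

Lemma LamC c : Lam c%:P = a *: N c.
Proof. by rewrite /Lam gradtC JnegC EulerC scaler0 !addr0. Qed.

Lemma gradtX g : gradt ('X * g) = 'X * gradt g.
Proof.
apply: (poly_monomialW (f := fun g => gradt ('X * g)) (g := fun g => 'X * gradt g)).
- by move=> x y; rewrite mulrDr raddfD.
- by move=> x y; rewrite raddfD /= mulrDr.
- by move=> d n; rewrite -scalerAr -exprS !gradtXn exprS mulrA.
Qed.

Lemma EulerX g : Euler ('X * g) = 'X * Euler g + 'X * g.
Proof. rewrite /Euler derivM derivX; ring. Qed.

(** Multiplying by X before the projection saves the terms that would land on X^(-1); they form the
    constant [Theta ('X * g)]. *)
Lemma JnegX g : Jneg ('X * g) = 'X * Jneg g + (Theta ('X * g))%:P.
Proof.
apply: (poly_monomialW (f := fun g => Jneg ('X * g))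
  (g := fun g => 'X * Jneg g + (Theta ('X * g))%:P)).
- by move=> x y; rewrite mulrDr raddfD.
- by move=> x y; rewrite mulrDr !raddfD /=; ring.
- move=> d n; rewrite -scalerAr -exprS ThetaXn !JnegXn big_ord_recr /= subnn.
  rewrite expr0 alg_polyC mulr_sumr; congr (_ + _); apply: eq_bigr => j _.
  by rewrite -scalerAr -exprS subSn // -ltnS ltn_ord.
Qed.

Lemma LamX g : Lam ('X * g) = 'X * Lam g + b *: ('X * g) + (Theta ('X * g))%:P.
Proof. rewrite /Lam gradtX JnegX EulerX -!mul_polyC; ring. Qed.

(* The Laplace-Beltrami operator [LB] on functions of [p], and its lift [LBt] in
   which one variable [p_n] is marked as ['X^n]. *)
Definition LB f := h * (Theta (Lam (N f)) - b * Theta (N f)).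
Fact LB_additive : zmod_morphism LB.
Proof. by move=> x y; rewrite /LB !raddfB /=; ring. Qed.
HB.instance Definition _ := GRing.isZmodMorphism.Build A A LB LB_additive.

Definition LBt g := map_poly LB g
  + (a *: gradt (Euler g) + Euler (Jneg g) + (h * b) *: (Euler (Euler g) - Euler g)).
Fact LBt_additive : zmod_morphism LBt.
Proof. move=> x y; rewrite /LBt !raddfB /= -!mul_polyC; ring. Qed.
HB.instance Definition _ :=
  GRing.isZmodMorphism.Build {poly A} {poly A} LBt LBt_additive.

Lemma LBtD : {morph LBt : x y / x + y}. Proof. exact: raddfD. Qed.

Lemma LB_const c f : isconst c -> LB (c * f) = c * LB f.
Proof.
move=> cc; rewrite /LB N_const // LamZ cc mul0r scaler0 addr0 !ThetaZ; ring.
Qed.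

Lemma LBt_const c g : isconst c -> LBt (c *: g) = c *: LBt g.
Proof.
move=> cc; rewrite /LBt; have -> : map_poly LB (c *: g) = c *: map_poly LB g.
  by apply/polyP=> i; rewrite coefZ !coef_map coefZ /= LB_const.
rewrite !EulerZ gradtZ cc JnegZ !EulerZ -!mul_polyC; ring.
Qed.

Lemma LBtC f : LBt f%:P = (LB f)%:P.
Proof.
by rewrite /LBt map_polyC EulerC JnegC !raddf0 add0r scaler0 !addr0.
Qed.

Lemma LBtX g : LBt ('X * g) = 'X * LBt g + 'X * Lam g.
Proof.
rewrite /LBt; have -> : map_poly LB ('X * g) = 'X * map_poly LB g.
  by apply/polyP=> i; rewrite coef_map !coefXM coef_map; case: eqP; rewrite //= raddf0.
(* Commuting [Euler] squared minus [Euler] past X gives twice X [Euler], so the coefficient [h * b]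
   must add up to [b]. *)
have hb : b%:P = (h * b)%:P + (h * b)%:P :> {poly A} by rewrite -polyCD -mulrDl h2 mul1r.
rewrite /Lam !EulerX JnegX !raddfD /= !gradtX !EulerX EulerC -!mul_polyC hb; ring.
Qed.

(* The two quadratic forms agree after the reversal [j |-> l - j]. *)
Lemma Theta_Euler_Jneg c l :
  Theta (Euler (Jneg (c *: 'X^l))) *+ 2 = Theta (Jneg (c *: 'X^l)) *+ l.
Proof.
have ThJ : Theta (Jneg (c *: 'X^l)) = \sum_(j < l.+1) p (l - j)%N * (p j * c).
  by rewrite JnegXn raddf_sum /=; apply: eq_bigr => j _; rewrite ThetaXn.
have ThEJ : Theta (Euler (Jneg (c *: 'X^l))) =
    \sum_(j < l.+1) p (l - j)%N * (p j * c) *+ (l - j).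
  rewrite JnegXn !raddf_sum /=; apply: eq_bigr => j _.
  by rewrite EulerXn ThetaXn mulrnAr.
rewrite mulr2n ThJ -sumrMnl {2}ThEJ (reindex_inj rev_ord_inj) ThEJ -big_split.
apply: eq_bigr => j _ /=; rewrite subSS subKn -1?ltnS //.
rewrite mulrCA [p j * (_ * _)]mulrCA -mulrnDr subnK -1?ltnS //.
Qed.

Lemma halfE x : x = h * x + h * x.
Proof. by rewrite -mulrDl h2 mul1r. Qed.

(** For p_l f the Leibniz rule yields the mixed term a l X^l N f twice, which absorbs the factor
    [h]. The terms p_(l-j) p_j match by [Theta_Euler_Jneg]. *)
Lemma LB_Theta g : LB (Theta g) = Theta (LBt g).
Proof.
apply: (poly_monomialW (f := fun g => LB (Theta g)) (g := fun g => Theta (LBt g))).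
- by move=> x y; rewrite !raddfD.
- by move=> x y; rewrite (raddfD LBt) (raddfD Theta).
move=> f l; rewrite ThetaXn.
have -> : LBt (f *: 'X^l) = (LB f) *: 'X^l
  + ((a *+ l) *: ('X^l * N f) + Euler (Jneg (f *: 'X^l))
     + (h * b * f * (l%:R * l%:R - l%:R)) *: 'X^l).
  rewrite /LBt; congr (_ + (_ + _ + _)).
  - apply/polyP=> i; rewrite coef_map !coefZ coefXn /=.
    by case: (i == l); rewrite ?mulr1 // mulr0 raddf0 mulr0.
  - by rewrite EulerXn gradtXn raddfMn /= mulrnAr -scalerMnr -scalerMnl.
  - rewrite !EulerXn -scalerBl scalerA; congr (_ *: _).
    by rewrite -(mulr_natr (f *+ l)) -(mulr_natr f); ring.
have ThEJ : Theta (Euler (Jneg (f *: 'X^l))) = h * (f * l%:R * Theta (Jneg 'X^l)).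
  rewrite [LHS]halfE -mulr2n -mulrnAr Theta_Euler_Jneg JnegZ ThetaZ.
  by rewrite -(mulr_natr (f * _)); ring.
have Nfl : N (f * l%:R) = l%:R *: N f by rewrite mulr_natr raddfMn scaler_nat.
rewrite !ThetaD !ThetaZ ThEJ !Theta_Xn /LB NM Np !LamD LamZ Np -scalerAl scalerA.
rewrite scalerA [Lam (_ *: 'X^_)]/Lam gradtXn Nfl JnegZ EulerXn -scalerAr.
rewrite !(ThetaD, ThetaZ, Theta_Xn) -(mulr_natr (f * _)) -(mulr_natr a).
rewrite [in RHS](halfE (a * l%:R * _)); ring.
Qed.

Lemma coef_Jneg s g : (Jneg g)`_s = Theta (drop_poly s g).
Proof.
apply: (poly_monomialW (f := fun g => (Jneg g)`_s) (g := fun g => Theta (drop_poly s g))).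
- by move=> x y; rewrite (raddfD Jneg) coefD.
- by move=> x y; rewrite drop_polyD ThetaD.
move=> c n; rewrite JnegXn coef_sum.
case: (leqP s n) => [le_sn|lt_ns].
  have -> : drop_poly s (c *: 'X^n) = c *: 'X^(n - s).
    apply/polyP=> i; rewrite coef_drop_poly !coefZ !coefXn.
    by rewrite -(eqn_add2r s i) subnK.
  rewrite ThetaXn (bigD1 (inord (n - s))) //= inordK ?ltnS ?leq_subr //.
  rewrite subKn // coefZ coefXn eqxx mulr1 big1 ?addr0 // => i neq_i.
  rewrite coefZ coefXn; case: eqP; rewrite ?mulr0 // => s_ni.
  by rewrite s_ni subKn -1?ltnS // inord_val eqxx in neq_i.
have -> : drop_poly s (c *: 'X^n) = 0.
  apply/polyP=> i; rewrite coef_drop_poly !coefZ !coefXn coef0.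
  by rewrite gtn_eqF ?mulr0 // (leq_trans lt_ns) // leq_addl.
rewrite raddf0 big1 // => i _; rewrite coefZ coefXn gtn_eqF ?mulr0 //.
by rewrite (leq_ltn_trans (leq_subr _ _)).
Qed.

Lemma coef_Euler s g : (Euler g)`_s = g`_s *+ s.
Proof.
by rewrite /Euler coefXM coef_deriv; case: s => [|s]; rewrite ?mulr0n.
Qed.

(** * Commutation with the single derivation s d/dp_s *)

Section CoefficientDerivation.
Variable s : nat.

Definition gradc f := (N f)`_s.
Fact gradc_additive : zmod_morphism gradc.
Proof. by move=> x y; rewrite /gradc raddfB coefB. Qed.
HB.instance Definition _ := GRing.isZmodMorphism.Build A A gradc gradc_additive.

Lemma gradc_M f g : gradc (f * g) = f * gradc g + g * gradc f.
Proof. by rewrite /gradc NM coefD !coefZ. Qed.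

Lemma gradc_const c f : isconst c -> gradc (c * f) = c * gradc f.
Proof. by move=> cc; rewrite /gradc N_const // coefZ. Qed.

Lemma map_gradcXn c n : map_poly gradc (c *: 'X^n) = gradc c *: 'X^n.
Proof.
apply/polyP=> i; rewrite coef_map !coefZ coefXn /=.
by case: (i == n); rewrite ?mulr1 // mulr0 raddf0 mulr0.
Qed.

Lemma map_gradc_const c g : isconst c -> map_poly gradc (c *: g) = c *: map_poly gradc g.
Proof.
by move=> cc; apply/polyP=> i; rewrite coefZ !coef_map coefZ /= gradc_const.
Qed.

Lemma map_gradcN f : map_poly gradc (N f) = N (gradc f).
Proof. by apply/polyP=> i; rewrite coef_map /= /gradc NC. Qed.

Lemma gradc_p l : gradc (p l) = (l == s)%:R * s%:R.
Proof.
rewrite /gradc Np coefZ coefXn eq_sym; case: eqP => [->|]; rewrite ?mulr1 ?mul1r //.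
by rewrite mulr0 mul0r.
Qed.

(** The derivation hits either a coefficient or the explicit factor p_s; the latter leaves s times
    the coefficient of X^s. *)
Lemma gradc_Theta g : gradc (Theta g) = Theta (map_poly gradc g) + g`_s *+ s.
Proof.
apply: (poly_monomialW (f := fun g => gradc (Theta g))
  (g := fun g => Theta (map_poly gradc g) + g`_s *+ s)).
- by move=> x y; rewrite ThetaD (raddfD gradc).
- by move=> x y; rewrite raddfD ThetaD coefD mulrnDl; ring.
move=> c n; rewrite map_gradcXn !ThetaXn gradc_M gradc_p coefZ coefXn eq_sym -mulr_natr.
ring.
Qed.

Lemma map_gradc_Jneg g :
  map_poly gradc (Jneg g) = Jneg (map_poly gradc g) + drop_poly s g *+ s.
Proof.
apply/polyP=> i; rewrite coef_map coefD coefMn !coef_Jneg coef_drop_poly /= gradc_Theta.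
rewrite coef_drop_poly addnC; congr (Theta _ + _).
by apply/polyP=> j; rewrite !(coef_map, coef_drop_poly).
Qed.

Lemma map_gradc_Euler g : map_poly gradc (Euler g) = Euler (map_poly gradc g).
Proof. by apply/polyP=> i; rewrite coef_map !coef_Euler coef_map raddfMn. Qed.

Lemma map_gradc_gradt g : map_poly gradc (gradt g) = gradt (map_poly gradc g).
Proof.
apply: (poly_monomialW (f := fun g => map_poly gradc (gradt g))
  (g := fun g => gradt (map_poly gradc g))).
- by move=> x y; rewrite (raddfD gradt) raddfD.
- by move=> x y; rewrite raddfD (raddfD gradt).
move=> c n; rewrite map_gradcXn !gradtXn -map_gradcN.
apply/polyP=> i; rewrite coef_map !coefXnM coef_map.
by case: ifP => //; rewrite raddf0.
Qed.

(** [gradt] and [Euler] commute with the coefficientwise derivation. Only the explicit p_j in [Jneg]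
    contribute, through a shift by s. *)
Lemma map_gradc_Lam g :
  map_poly gradc (Lam g) = Lam (map_poly gradc g) + drop_poly s g *+ s.
Proof.
rewrite /Lam 2!raddfD /= !map_gradc_const // map_gradc_gradt.
rewrite map_gradc_Jneg map_gradc_Euler; ring.
Qed.

Lemma gradc_LB f :
  gradc (LB f) = LB (gradc f)
    + h * ((Jneg (N f))`_s *+ s + (Lam (N f))`_s *+ s - b * gradc f *+ s).
Proof.
rewrite /LB gradc_const // raddfB /= gradc_const // !gradc_Theta map_gradc_Lam map_gradcN.
rewrite ThetaD raddfMn /= -coef_Jneg /gradc.
ring.
Qed.

End CoefficientDerivation.

Lemma coef_gradt s g : (gradt g)`_s = \sum_(i < s.+1) gradc (s - i) g`_i.
Proof.
apply: (poly_monomialW (f := fun g => (gradt g)`_s)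
  (g := fun g => \sum_(i < s.+1) gradc (s - i) g`_i)).
- by move=> x y; rewrite (raddfD gradt) coefD.
- by move=> x y; rewrite -big_split; apply: eq_bigr => i _; rewrite coefD raddfD.
move=> c n; rewrite gradtXn coefXnM; case: ltnP => [lt_sn|le_ns].
  rewrite big1 // => i _; rewrite coefZ coefXn ltn_eqF ?mulr0 ?raddf0 //.
  exact: leq_trans lt_sn.
rewrite (bigD1 (inord n)) //= inordK ?ltnS // coefZ coefXn eqxx mulr1 big1 ?addr0 //.
move=> i neq_i; rewrite coefZ coefXn; case: eqP => [i_n|]; last first.
  by rewrite mulr0 raddf0.
by rewrite -i_n inord_val eqxx in neq_i.
Qed.

(* Symmetry of second derivatives, summed over [i + j = s]. *)
Lemma gradt_Euler_N f : gradt (Euler (N f)) *+ 2 = Euler (gradt (N f)).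
Proof.
apply/polyP=> s; rewrite coefMn mulr2n coef_Euler !coef_gradt -sumrMnl.
rewrite {1}(reindex_inj rev_ord_inj) -big_split; apply: eq_bigr => i _ /=.
rewrite subSS subKn -1?ltnS // !coef_Euler !raddfMn /= {1}/gradc NC -mulrnDr.
by rewrite subnK -1?ltnS.
Qed.

(** This is the constant case of the commutation of [LBt] with [Lam], since [Lam] sends a constant f
    to a N f. *)
Lemma LBt_N f : LBt (N f) = N (LB f).
Proof.
apply/polyP=> s; rewrite -[RHS]/(gradc s (LB f)) gradc_LB.
have aE : a * (gradt (Euler (N f)))`_s = h * (a * (gradt (N f))`_s) *+ s.
  rewrite [LHS]halfE -mulr2n -!mulrnAr -coefMn gradt_Euler_N coef_Euler.
  by rewrite mulrnAr.
rewrite /LBt !coefD !coefZ aE coef_map coefB !coef_Euler /=.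
(* In [gradc_LB] the [Jneg] term occurs once explicitly and once inside [Lam], each time with weight
   [h]. *)
rewrite [X in _ + (_ + X + _) = _]halfE /gradc.
ring.
Qed.

(** Induction on the degree: the case X g reduces to g by the commutation rules with X, and the
    constant produced by [LamX] is matched through [LB_Theta]. *)
Lemma LBt_Lam g : LBt (Lam g) = Lam (LBt g).
Proof.
elim/poly_ind: g => [|g c IH]; first by rewrite !raddf0.
rewrite mulrC LamD (LBtD (Lam _)) (LBtD ('X * g)) LamD; congr (_ + _).
  rewrite LBtX LamD !LamX (LBtD (_ + _)) LBtD LBt_const // !LBtX IH LBtC LB_Theta LBtX.
  rewrite ThetaD polyCD -!mul_polyC; ring.
by rewrite LBtC !LamC LBt_const // LBt_N.
Qed.

Lemma Lam_const c g : isconst c -> Lam (c *: g) = c *: Lam g.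
Proof. by move=> cc; rewrite LamZ cc mul0r scaler0 addr0. Qed.

Variable ai : A.
Hypotheses (cai : isconst ai) (aK : a * ai = 1).

Lemma LamZp1 g :
  Lam ((ai * Theta 'X) *: g) = (ai * Theta 'X) *: Lam g + 'X * g.
Proof.
rewrite -[X in Theta X]expr1 Theta_Xn LamZ N_const // Np scale1r expr1.
by rewrite -scalerAl scalerA aK scale1r.
Qed.

Lemma isconst0 : isconst 0. Proof. exact: raddf0. Qed.

Lemma Fock_commutator us m f : consts isconst us ->
  OmegaQ Theta Lam ai us (Theta (iter m (step Lam us) f%:P))
    - Theta (iter m (step Lam us) (OmegaQ Theta Lam ai us f)%:P) =
  Theta (iter m.+1 (step Lam us) f%:P) *+ m.
Proof.
move=> cus; exact: (OmegaQ_commutator isconst0 ThetaZ LB_const Lam_const LBt_const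
  LBtC LB_Theta LBtX LBt_Lam cai LamZp1 cus).
Qed.

End Fock.

(** * From operators in the y-variables to polynomials in t *)

(* The operators of the statement over an abstract algebra with derivations: on
   the concrete monoid algebra, failing unifications unfold too far. *)
Section Transfer.
Variables (F : fieldType) (A : comAlgType F).
Variables (pp yy : nat -> A) (dp dy : nat -> {additive A -> A}) (vb : A -> nat).
Hypothesis dpZ : forall i c f, dp i (c *: f) = c *: dp i f.
Hypothesis dyZ : forall i c f, dy i (c *: f) = c *: dy i f.
Hypothesis dpM : forall i f g, dp i (f * g) = f * dp i g + g * dp i f.
Hypothesis dyM : forall i f g, dy i (f * g) = f * dy i g + g * dy i f.
Hypothesis dp_pp : forall i j, dp i (pp j) = (i == j)%:R.
Hypothesis dy_yy : forall i j, dy i (yy j) = (i == j)%:R.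
Hypothesis dy_pp : forall i j, dy i (pp j) = 0.
Hypothesis dp_dp : forall i j f, dp i (dp j f) = dp j (dp i f).
Hypothesis dy_dp : forall i j f, dy i (dp j f) = dp j (dy i f).
Hypothesis dp_vb : forall i f, (vb f <= i)%N -> dp i f = 0.
Hypothesis dy_vb : forall i f, (vb f <= i)%N -> dy i f = 0.

Definition gTheta g := \sum_(1 <= i < (vb g).+1) pp i * dy i g.

Definition gYplus g := \sum_(0 <= i < (vb g).+1) yy i.+1 * dy i g.

Definition gLambda (b : F) g : A :=
  (1 + b) *: (\sum_(1 <= i < (vb g).+1) \sum_(1 <= j < (vb g).+1)
       i%:R * yy (i + j - 1) * dp i (dy (j - 1) g))
  + (\sum_(1 <= i < (vb g).+1) \sum_(1 <= j < (vb g).+1)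
       yy (i - 1) * pp j * dy (i + j - 1) g)
  + b *: (\sum_(0 <= i < (vb g).+1) i%:R * yy i * dy i g).

Fixpoint gprod (b : F) (us : seq F) g : A :=
  match us with
  | [::] => g
  | c :: us' => gLambda b (gprod b us' g) + c *: gprod b us' g
  end.

Definition gy0div (b : F) g : A := (1 + b)^-1 *: (yy 0 * g).

(* Theta_Y kills y_0, hence [p_0 = 0]. *)
Definition pvar i : A := if i is _.+1 then pp i else 0.

Definition grad (f : A) : {poly A} := \poly_(i < vb f) (dp i f *+ i).

Lemma coef_grad f i : (grad f)`_i = dp i f *+ i.
Proof.
by rewrite coef_poly; case: ltnP => // /dp_vb ->; rewrite mul0rn.
Qed.

Fact grad_zmod_morphism : zmod_morphism grad.
Proof.
by move=> f g; apply/polyP => i; rewrite coefB !coef_grad raddfB mulrnBl.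
Qed.
HB.instance Definition _ := GRing.isZmodMorphism.Build A {poly A} grad grad_zmod_morphism.

Lemma gradM f g : grad (f * g) = f *: grad g + g *: grad f.
Proof.
by apply/polyP => i; rewrite coefD !coefZ !coef_grad dpM mulrnDl -!mulrnAr.
Qed.

Lemma grad_pvar l : grad (pvar l) = l%:R *: 'X^l.
Proof.
apply/polyP => i; rewrite coefZ coefXn coef_grad /pvar; case: l => [|l].
  by rewrite raddf0 mul0rn mul0r.
rewrite dp_pp; case: eqP => [->|_]; first by rewrite mulr1.
by rewrite mulr0 mul0rn.
Qed.

Lemma gradC f r s : (grad (grad f)`_r)`_s = (grad (grad f)`_s)`_r.
Proof. by rewrite !coef_grad !raddfMn /= dp_dp -!mulrnA mulnC. Qed.

Lemma isconst_alg (c : F) : isconst grad (c%:A).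
Proof.
have dp1 i : dp i 1 = 0.
  by apply: (addrI (dp i 1)); rewrite addr0 -{3}(mulr1 1) dpM !mul1r.
by apply/polyP => i; rewrite coef_grad dpZ dp1 scaler0 mul0rn coef0.
Qed.

(** Independence of the y's in terms of derivations alone; for the concrete ones it follows from
    [is_ppoly]. *)
Definition yfree f := forall j, dy j f = 0.
Definition yfreep (h : {poly A}) := forall i, yfree h`_i.

Lemma yfree0 : yfree 0. Proof. by move=> j; rewrite raddf0. Qed.
Lemma yfreeD f g : yfree f -> yfree g -> yfree (f + g).
Proof. by move=> f0 g0 j; rewrite raddfD /= f0 g0 addr0. Qed.
Lemma yfreeM f g : yfree f -> yfree g -> yfree (f * g).
Proof. by move=> f0 g0 j; rewrite dyM f0 g0 !mulr0 addr0. Qed.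
Lemma yfreeZ c f : yfree f -> yfree (c *: f).
Proof. by move=> f0 j; rewrite dyZ f0 scaler0. Qed.
Lemma yfreeMn n f : yfree f -> yfree (f *+ n).
Proof. by move=> f0 j; rewrite raddfMn /= f0 mul0rn. Qed.
Lemma yfree_sum I (r : seq I) (P : pred I) (G : I -> A) :
  (forall i, yfree (G i)) -> yfree (\sum_(i <- r | P i) G i).
Proof. by move=> G0 j; rewrite raddf_sum big1 // => i _; exact: G0. Qed.
Lemma yfree_pvar i : yfree (pvar i).
Proof. by case: i => [|i] j; rewrite ?raddf0 ?dy_pp. Qed.
Lemma yfree_dp i f : yfree f -> yfree (dp i f).
Proof. by move=> f0 j; rewrite dy_dp f0 raddf0. Qed.

Lemma yfree_Theta h : yfreep h -> yfree (Theta pvar h).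
Proof.
move=> h0; apply: yfree_sum => i; apply: yfreeM; first exact: yfree_pvar.
exact: h0.
Qed.

Variable b : F.
Hypothesis b1 : 1 + b != 0.
Let a := (1 + b)%:A : A.
Let ai := ((1 + b)^-1)%:A : A.
Let L := Lam pvar grad a b%:A.

Lemma yfreep_Lam h : yfreep h -> yfreep (L h).
Proof.
move=> h0 s; rewrite /L /Lam !coefD !coefZ coef_Jneg coef_gradt coef_Euler !mulr_algl.
apply: yfreeD; [apply: yfreeD|]; last by apply/yfreeZ/yfreeMn.
  apply/yfreeZ/yfree_sum => i; rewrite /gradc coef_grad.
  exact/yfreeMn/yfree_dp.
by apply: yfree_Theta => i; rewrite coef_drop_poly.
Qed.

Lemma yfreepX h : yfreep h -> yfreep ('X * h).
Proof. by move=> h0 i; rewrite coefXM; case: eqP => // _; exact: yfree0. Qed.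

(* [Phi] reads ['X^n] as y_n: only the part linear in the y's matters. *)
Definition ymul i (c : A) := c * yy i.
Fact ymul_zmod_morphism i : zmod_morphism (ymul i).
Proof. by move=> x y; rewrite /ymul mulrBl. Qed.
HB.instance Definition _ i :=
  GRing.isZmodMorphism.Build A A (ymul i) (ymul_zmod_morphism i).

Definition Phi : {poly A} -> A := lext ymul.
HB.instance Definition _ := GRing.Additive.on Phi.

Lemma PhiXn c n : Phi (c *: 'X^n) = c * yy n.
Proof. exact: lextXn. Qed.

Lemma PhiEw n (h : {poly A}) :
  (size h <= n)%N -> Phi h = \sum_(0 <= i < n) h`_i * yy i.
Proof. by move=> hn; rewrite /Phi (lextEw _ hn) big_mkord. Qed.

Lemma PhiZ (c : F) h : Phi (c%:A *: h) = c *: Phi h.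
Proof.
rewrite (@PhiEw (size h)) ?size_scale_leq // (@PhiEw (size h)) //.
rewrite scaler_sumr; apply: eq_bigr => i _.
by rewrite coefZ mulr_algl scalerAl.
Qed.

Lemma dy_Phi j h : yfreep h -> dy j (Phi h) = h`_j.
Proof.
move=> h0; rewrite (@PhiEw (maxn j.+1 (size h))) ?leq_maxr // raddf_sum /=.
rewrite (bigD1_seq j) ?mem_index_iota ?iota_uniq //=; last by rewrite leq_maxl.
rewrite dyM dy_yy eqxx mulr1 h0 mulr0 addr0 big1 ?addr0 // => i neq_ij.
by rewrite dyM dy_yy eq_sym (negPf neq_ij) h0 !mulr0 addr0.
Qed.

(** * The y-operators on elements linear in the y's *)

Section Readout.
Variable h : {poly A}.
Hypothesis h0 : yfreep h.
Let v := vb (Phi h).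

Lemma coef_vb i : (v <= i)%N -> h`_i = 0.
Proof. by move=> vi; rewrite -(dy_Phi i h0); exact: dy_vb. Qed.

Lemma size_vb : (size h <= v)%N.
Proof. by apply/leq_sizeP => i; exact: coef_vb. Qed.

(** By [dy_Phi] a coefficient of [h] is a y-derivative of [Phi h]. Derivatives commute, so the bound
    for [Phi h] also controls the p-variables in the coefficients. *)
Lemma dp_coef_vb i j : (v <= i)%N -> dp i h`_j = 0.
Proof. by move=> vi; rewrite -(dy_Phi j h0) -dy_dp dp_vb ?raddf0. Qed.

Lemma ThetaEw n (g : {poly A}) : (size g <= n)%N ->
  Theta pvar g = \sum_(1 <= i < n.+1) pp i * g`_i.
Proof.
move=> gn; have gn1 : (size g <= n.+1)%N by exact: leqW.
rewrite /Theta (lextEw _ gn1) -(big_mkord xpredT (fun i => pmul pvar i g`_i)).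
rewrite big_ltn // /pmul mul0r add0r; apply: eq_big_nat => i.
by case: i.
Qed.

Lemma gTheta_Phi : gTheta (Phi h) = Theta pvar h.
Proof.
rewrite (ThetaEw size_vb) /gTheta; apply: eq_bigr => i _.
by rewrite dy_Phi.
Qed.

Lemma gYplus_Phi : gYplus (Phi h) = Phi ('X * h).
Proof.
(* Dropping X^0 and shifting the index leaves 0 <= i <= v, the range in [gYplus]. *)
rewrite [RHS](@PhiEw v.+2); last first.
  apply/leq_sizeP => i vi; rewrite coefXM; case: i vi => // i vi /=.
  by rewrite coef_vb // ltnW.
rewrite big_ltn // coefXM eqxx mul0r add0r big_add1 /=.
by apply: eq_bigr => i _; rewrite dy_Phi // coefXM /= mulrC.
Qed.

Lemma gLambda_Phi : gLambda b (Phi h) = Phi (L h).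
Proof.
rewrite /L /Lam !raddfD /= !PhiZ /gLambda -/v; congr (_ *: _ + _ + _ *: _).
- have NhE : gradt grad h = \sum_(0 <= i < v.+1) \sum_(0 <= j < v)
      (dp i h`_j *+ i) *: 'X^(i + j).
    rewrite exchange_big /gradt (lextEw _ size_vb) big_mkord; apply: eq_bigr => j _.
    transitivity ('X^j * \poly_(i < v.+1) (dp i h`_j *+ i)).
      congr (_ * _); apply/polyP => i; rewrite coef_grad coef_poly.
      by case: ltnP => // vi; rewrite dp_coef_vb ?mul0rn // ltnW.
    rewrite poly_def mulr_sumr big_mkord; apply: eq_bigr => i _.
    by rewrite -scalerAr -exprD addnC.
  (* The row i = 0 vanishes by its weight i, matching a sum that starts at 1. *)
  rewrite NhE raddf_sum [RHS]big_ltn //=.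
  rewrite [X in _ = Phi X + _]big1 ?raddf0 ?add0r => [|j _];
    last by rewrite mulr0n scale0r.
  apply: eq_bigr => i _; rewrite big_add1 raddf_sum /=; apply: eq_bigr => j _.
  by rewrite PhiXn subn1 dy_Phi // addnS subn1 -mulr_natr; ring.
- rewrite [RHS](@PhiEw v); last first.
    apply/leq_sizeP => i vi; rewrite coef_Jneg /Theta (@lextEw _ _ _ 0) ?big_ord0 //.
    by apply/leq_sizeP => j _; rewrite coef_drop_poly coef_vb // (leq_trans vi) ?leq_addl.
  rewrite big_add1 /=; apply: eq_bigr => i _; rewrite coef_Jneg (@ThetaEw v).
    rewrite mulr_suml; apply: eq_bigr => j _.
    rewrite subn1 dy_Phi // coef_drop_poly addSn subn1 /= addnC; ring.
  apply/leq_sizeP => j vj.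
  by rewrite coef_drop_poly coef_vb // (leq_trans vj) // leq_addr.
- rewrite [RHS](@PhiEw v.+1); last first.
    apply/leq_sizeP => i vi; rewrite coef_Euler coef_vb ?mul0rn // ltnW //.
  apply: eq_bigr => i _; rewrite dy_Phi // coef_Euler -mulr_natr; ring.
Qed.

End Readout.

Lemma gy0divE f : gy0div b f = Phi (ai * f)%:P.
Proof.
rewrite -[_%:P]alg_polyC -(expr0 'X) PhiXn /gy0div /ai mulr_algl -scalerAl.
by rewrite mulrC.
Qed.

Lemma yfreepC f : yfree f -> yfreep f%:P.
Proof. by move=> f0 i; rewrite coefC; case: eqP => // _; exact: yfree0. Qed.

Definition cst (us : seq F) : seq A := [seq c%:A | c <- us].

Lemma yfreep_prodLam us h : yfreep h -> yfreep (prodLam L (cst us) h).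
Proof.
move=> h0; elim: us => [//|c us IH] i /=.
rewrite coefD coefZ mulr_algl; apply: yfreeD; first exact: yfreep_Lam.
exact: yfreeZ.
Qed.

Lemma gprod_Phi us h : yfreep h -> gprod b us (Phi h) = Phi (prodLam L (cst us) h).
Proof.
move=> h0; elim: us => [//|c us IH] /=.
rewrite IH (raddfD Phi (L _)) /= PhiZ gLambda_Phi //; exact: yfreep_prodLam.
Qed.

Lemma consts_cst us : consts (isconst grad) (cst us).
Proof. by move=> _ /mapP[c _ ->]; exact: isconst_alg. Qed.

Definition gBk (us : seq F) (m : nat) g : A :=
  (m.-1)`!%:R *: gTheta (iter m (fun x => gYplus (gprod b us x)) (gy0div b g)).

Definition gOmega (us : seq F) g : A :=
  gTheta (gYplus (gprod b us (gLambda b (gy0div b g)))).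

(** * The commutator identity for the generic operators *)

Section Commutator.
Variable us : seq F.
Let Th := Theta pvar.
Let B m f := Th (iter m (step L (cst us)) f%:P).
Let W f := OmegaQ Th L ai (cst us) f.

Lemma yfreep_step h : yfreep h -> yfreep (step L (cst us) h).
Proof. by move=> h0; apply/yfreepX/yfreep_prodLam. Qed.

Lemma LamZc c g : isconst grad c -> L (c *: g) = c *: L g.
Proof. exact: (Lam_const pvar gradM). Qed.

Lemma gOmegaE f : yfree f -> gOmega us f = W f.
Proof.
move=> f0; have aif0 : yfreep (ai * f)%:P.
  by apply: yfreepC; rewrite /ai mulr_algl; exact: yfreeZ.
rewrite /gOmega gy0divE gLambda_Phi // gprod_Phi; last exact: yfreep_Lam.
have QL0 := yfreep_prodLam us (yfreep_Lam aif0).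
rewrite gYplus_Phi // gTheta_Phi; last exact: yfreepX.
have cai := isconst_alg (1 + b)^-1.
rewrite /W /OmegaQ polyCM mul_polyC LamZc // (prodLam_const LamZc _ (@consts_cst us)) //.
by rewrite -scalerAr ThetaZ.
Qed.

Lemma yfree_W f : yfree f -> yfree (W f).
Proof.
move=> f0; rewrite /W /OmegaQ /ai mulr_algl; apply/yfreeZ/yfree_Theta.
exact/yfreepX/yfreep_prodLam/yfreep_Lam/yfreepC.
Qed.

Lemma yfreep_iter m h : yfreep h -> yfreep (iter m (step L (cst us)) h).
Proof. by move=> h0; elim: m => //= m IH; exact: yfreep_step. Qed.

Lemma gBkE m f : yfree f -> gBk us m f = (m.-1)`!%:R *: ((1 + b)^-1 *: B m f).
Proof.
move=> f0; have aif0 : yfreep (ai * f)%:P.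
  by apply: yfreepC; rewrite /ai mulr_algl; exact: yfreeZ.
have iterE : iter m (fun x => gYplus (gprod b us x)) (Phi (ai * f)%:P) =
    Phi (iter m (step L (cst us)) (ai * f)%:P).
  elim: m => //= m ->; rewrite gprod_Phi; last exact: yfreep_iter.
  by rewrite gYplus_Phi //; apply/yfreep_prodLam/yfreep_iter.
rewrite /gBk gy0divE iterE gTheta_Phi; last exact: yfreep_iter.
have cai := isconst_alg (1 + b)^-1.
rewrite /B polyCM mul_polyC (iter_step_const LamZc (@consts_cst us)) //.
by rewrite /Th ThetaZ /ai mulr_algl.
Qed.

Lemma W_Z c f : W (c *: f) = c *: W f.
Proof.
rewrite -mulr_algl /W (OmegaQ_const (ThetaZ pvar) LamZc _ (@consts_cst us)) //.
  by rewrite mulr_algl.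
exact: isconst_alg.
Qed.

Hypothesis two_neq0 : 2%:R != 0 :> F.

Lemma gBk_commutator m f : (0 < m)%N -> yfree f ->
  gBk us m.+1 f = gOmega us (gBk us m f) - gBk us m (gOmega us f).
Proof.
move=> m_gt0 f0; have Bf0 : yfree (B m f).
  exact/yfree_Theta/yfreep_iter/yfreepC.
rewrite [gOmega us f]gOmegaE // [gBk us m f]gBkE // gOmegaE; last by do 2!apply: yfreeZ.
rewrite [gBk us m.+1 f]gBkE // gBkE; last exact: yfree_W.
have comm : W (B m f) - B m (W f) = B m.+1 f *+ m.
  have half : (2%:R^-1)%:A + (2%:R^-1)%:A = 1 :> A.
    by rewrite -scalerDl -[2%:R^-1]mulr1 -mulrDr mulVf // scale1r.
  have aK : a * ai = 1 by rewrite mulr_algl scalerA divff // scale1r.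
  have cA := isconst_alg.
  exact: (Fock_commutator (erefl _) gradM grad_pvar gradC (cA _) (cA _) (cA _)
    half (cA _) aK m f (@consts_cst us)).
rewrite !W_Z -!scalerBr comm -!scalerMnr scalerMnl -mulrnA /=.
(* The scalars agree by (m-1)! m = m!, which fails at m = 0, where [m.-1] truncates. *)
by case: m m_gt0 {Bf0 comm} => // m _; rewrite factS mulnC.
Qed.

End Commutator.
End Transfer.

(* Sealing the monomials and the derivation keeps unification from unfolding
   the finitely supported functions underneath. *)
HB.lock Definition mon (F : fieldType) (c : F) (m : {cmonom var}) : polyPY F :=
  << c *g m >>.
HB.lock Definition der (F : fieldType) (v : var) (g : polyPY F) : polyPY F :=
  pd v g.

(** * Partial derivatives on the monoid algebra *)

Section PartialDerivative.
Variable F : fieldType.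
Implicit Types (f g : polyPY F) (v w : var) (m : {cmonom var}) (c : F).

Lemma monM c c' m m' : mon c m * mon c' m' = mon (c * c') (mmul m m').
Proof. by rewrite mon.unlock malgM_def fgmulUU. Qed.

Lemma monZ c c' m : c *: mon c' m = mon (c * c') m.
Proof. by rewrite mon.unlock -mul_malgC malgM_def fgmulUU Monoid.mul1m. Qed.

Lemma monD c c' m : mon (c + c') m = mon c m + mon c' m.
Proof. by rewrite mon.unlock monalgUD. Qed.

Lemma mon0 m : mon 0 m = 0 :> polyPY F.
Proof. by rewrite mon.unlock monalgU0. Qed.

Lemma mon1 : mon 1 mone = 1 :> polyPY F.
Proof. by rewrite mon.unlock. Qed.

Lemma X_mon v : X F v = mon 1 (ucm v).
Proof. by rewrite mon.unlock. Qed.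

Lemma mon_sum g : g = \sum_(m <- msupp g) mon g@_m m.
Proof. by rewrite mon.unlock; exact: monalgE. Qed.

(** The sum over the support of [g] is hard to compare for different [g]; as an [mmap] it is
    additive at once. *)
Lemma der_mmap v g :
  der v g = mmap (@malgC _ F) (fun m => mon (m v)%:R (divcm m (ucm v))) g.
Proof.
rewrite der.unlock; apply: eq_bigr => m _.
by rewrite mon.unlock malgM_def fgmulUU Monoid.mul1m.
Qed.

Fact der_zmod_morphism v : zmod_morphism (@der F v).
Proof.
move=> f g; rewrite (der_mmap v f) (der_mmap v g) (der_mmap v (f - g)).
exact: raddfB.
Qed.
HB.instance Definition _ v :=
  GRing.isZmodMorphism.Build (polyPY F) (polyPY F) (@der F v)
    (der_zmod_morphism v).

Lemma der_mon v c m : der v (mon c m) = mon (c * (m v)%:R) (divcm m (ucm v)).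
Proof.
rewrite der_mmap [mon in X in mmap _ _ X]mon.unlock; etransitivity; first exact: mmapU.
by rewrite mon.unlock malgM_def fgmulUU Monoid.mul1m.
Qed.

Lemma mon_ind (V : zmodType) (h k : {additive polyPY F -> V}) :
  (forall c m, h (mon c m) = k (mon c m)) -> h =1 k.
Proof.
by move=> hk g; rewrite (mon_sum g) !raddf_sum; apply: eq_bigr => m _; exact: hk.
Qed.

Lemma derZ v c g : der v (c *: g) = c *: der v g.
Proof.
pose h : {additive _ -> _} := @der F v \o ( *:%R c).
pose k : {additive _ -> _} := ( *:%R c) \o @der F v.
apply: (mon_ind (h := h) (k := k)) => d m; rewrite /h /k /=.
by rewrite monZ !der_mon monZ mulrA.
Qed.

Lemma derC v w g : der v (der w g) = der w (der v g).
Proof.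
case: (eqVneq v w) => [->//|vw].
pose h : {additive _ -> _} := @der F v \o @der F w.
pose k : {additive _ -> _} := @der F w \o @der F v.
apply: (mon_ind (h := h) (k := k)) => c m; rewrite /h /k /=.
(* For distinct variables, dividing by one leaves the exponent of the other unchanged. *)
rewrite !der_mon !divcmE !ucmE (negPf vw) eq_sym (negPf vw) !subn0 mulrAC.
by congr mon; apply/eqP/cmP => i; rewrite !divcmE subnAC.
Qed.

Lemma der_X v w : der v (X F w) = (v == w)%:R.
Proof.
rewrite X_mon der_mon mul1r cmU eq_sym; case: eqP => [->|_]; last exact: mon0.
rewrite -[RHS]mon1.
by congr mon; apply/eqP/cmP => i; rewrite divcmE subnn cm1.
Qed.

Lemma derM v f g : der v (f * g) = f * der v g + g * der v f.
Proof.
(* [divcm] subtracts exponents with truncation, hence the positivity condition. When the exponent of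
   [v] is 0, the coefficient vanishes instead. *)
have divM m m' : (0 < m' v)%N ->
    mmul m (divcm m' (ucm v)) = divcm (mmul m m') (ucm v).
  move=> m'v; apply/eqP/cmP => i; rewrite divcmE !cmM divcmE cmU.
  by case: eqP => [<-|_]; rewrite ?subn0 // addnBA.
have MderM c c' m m' : mon c m * der v (mon c' m') =
    mon (c * c' * (m' v)%:R) (divcm (mmul m m') (ucm v)).
  rewrite der_mon monM mulrA; case: (posnP (m' v)) => [->|m'v].
    by rewrite mulr0 !mon0.
  by rewrite divM.
have derMM c c' m m' : der v (mon c m * mon c' m') =
    mon c m * der v (mon c' m') + mon c' m' * der v (mon c m).
  rewrite !MderM monM der_mon cmM natrD mulrDr monD [mmul m' m]Monoid.mulmC.
  by rewrite addrC [c' * c]mulrC.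
rewrite (mon_sum f) (mon_sum g).
rewrite mulr_suml !raddf_sum /= mulr_suml mulr_sumr -big_split.
apply: eq_bigr => m _ /=; rewrite mulr_sumr raddf_sum /= mulr_sumr mulr_suml.
by rewrite -big_split; apply: eq_bigr => k _; exact: derMM.
Qed.

Lemma der_eq0 v g : (forall m, m \in msupp g -> m v = 0%N) -> der v g = 0.
Proof.
move=> gv; rewrite der.unlock /pd big_seq big1 // => m /gv ->.
by rewrite mulr0 monalgU0.
Qed.

Lemma der_vbound v g : (vbound g <= vidx v)%N -> der v g = 0.
Proof.
move=> gv; apply: der_eq0 => m mg; apply/eqP; rewrite cmE_eq0.
apply: contraL gv => vm; rewrite -ltnNge /vbound.
apply: leq_trans (leq_bigmax_seq _ mg _) => //.
exact: (leq_bigmax_seq (F := fun v => (vidx v).+1) v).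
Qed.

End PartialDerivative.

(** * Instantiation at the operators of the theorem *)

Section Instance.
Variable F : fieldType.
Implicit Types (f g : polyPY F) (v w : var).

Lemma pd_der : @pd F = @der F.
Proof. by rewrite der.unlock. Qed.

Lemma pdZ v c g : pd v (c *: g) = c *: pd v g.
Proof. by rewrite pd_der derZ. Qed.

Lemma pdM v f g : pd v (f * g) = f * pd v g + g * pd v f.
Proof. by rewrite pd_der derM. Qed.

Lemma pdC v w g : pd v (pd w g) = pd w (pd v g).
Proof. by rewrite pd_der derC. Qed.

Lemma pd_X v w : pd v (X F w) = (v == w)%:R.
Proof. by rewrite pd_der der_X. Qed.

Lemma pd_vbound v g : (vbound g <= vidx v)%N -> pd v g = 0.
Proof. by rewrite pd_der; exact: der_vbound. Qed.

(** Stated for [pd] rather than the sealed [der], so that the generic operators instantiate to the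
    original ones by conversion. *)
Fact pd_zmod_morphism v : zmod_morphism (@pd F v).
Proof. by rewrite pd_der; exact: raddfB. Qed.
HB.instance Definition _ v :=
  GRing.isZmodMorphism.Build (polyPY F) (polyPY F) (@pd F v)
    (pd_zmod_morphism v).

Definition pd_p i : {additive polyPY F -> polyPY F} := @pd F (pv i).
Definition pd_y i : {additive polyPY F -> polyPY F} := @pd F (yv i).

Section Operators.
Let pX i : polyPY F := X F (pv i).
Let yX i : polyPY F := X F (yv i).
Local Notation instantiate op := (op pX yX pd_p pd_y (@vbound F)).

Lemma BkE b k (u : 'I_k -> F) m g :
  Bk b u m g = instantiate (@gBk F (polyPY F)) b (useq u) m g.
Proof. by []. Qed.

Lemma OmegaYE b k (u : 'I_k -> F) g :
  OmegaY b u g = instantiate (@gOmega F (polyPY F)) b (useq u) g.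
Proof. by []. Qed.

Lemma Bk_commutator b k (u : 'I_k -> F) m f :
  1 + b != 0 -> 2%:R != 0 :> F -> (0 < m)%N -> is_ppoly f ->
  Bk b u m.+1 f = OmegaY b u (Bk b u m f) - Bk b u m (OmegaY b u f).
Proof.
move=> b1 two m_gt0 f_p.
have f0 : yfree pd_y f.
  move=> j; rewrite /pd_y /= pd_der; apply: der_eq0 => n /f_p nf.
  by case: (nf j).
rewrite (BkE b u m.+1 f) (OmegaYE b u f) (BkE b u m f) BkE OmegaYE.
exact: (gBk_commutator (fun i => @pdZ (pv i)) (fun i => @pdZ (yv i))
  (fun i => @pdM (pv i)) (fun i => @pdM (yv i))
  (fun i j => pd_X (pv i) (pv j)) (fun i j => pd_X (yv i) (yv j))
  (fun i j => pd_X (yv i) (pv j))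
  (fun i j => pdC (pv i) (pv j)) (fun i j => pdC (yv i) (pv j))
  (fun i => @pd_vbound (pv i)) (fun i => @pd_vbound (yv i))
  b1 (useq u) two m_gt0 f0).
Qed.

End Operators.

End Instance.

Theorem theorem4p10 (F : fieldType) (charF0 : [pchar F] =i pred0)
  (b : F) (hb : 1 + b != 0) (k : nat) (hk : (1 <= k)%N) (u : 'I_k -> F) :
  (forall f : polyPY F, is_ppoly f ->
     Bk b u 1 f = ThetaY (Yplus (prodLambda b (useq u) (y0div b f))))
  /\
  (forall (m : nat) (f : polyPY F), (1 <= m)%N -> is_ppoly f ->
     Bk b u m.+1 f = OmegaY b u (Bk b u m f) - Bk b u m (OmegaY b u f)).
Proof.
split=> [f _|m f]; first by rewrite /Bk /= scale1r.
apply: Bk_commutator => //.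
(* As 2 is prime, its absence from the characteristic means that it is nonzero in [F]. *)
by have := charF0 2; rewrite !inE /= => ->.
Qed.
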